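(* For any given integer $m>0$, there is a periodic map $f$ on a closed connected orientable surface $F$ such that there is no $f$-equivariant embedding $e: F\to\mathbb{R}^m$.
   Context: A periodic map $f$ on $F$ is a homeomorphism $f: F\to F$ of finite order $n$; it generates a faithful action of the cyclic group $\mathbb{Z}_n$ on $F$. An embedding $e: F\to\mathbb{R}^m$ is called $f$-equivariant if, for the cyclic group $G=\langle f\rangle\cong\mathbb{Z}_n$, there is a group homomorphism $\tilde\rho: G\to SO(m)$, with $SO(m)$ acting canonically on $\mathbb{R}^m$, such that $e\circ g=\tilde\rho(g)\circ e$ for every $g\in G$. *)

(* Defs.v *)
From HB Require Import structures.
From mathcomp Require Import all_boot all_order all_algebra.
From mathcomp Require Import all_classical all_reals all_analysis.

Set Implicit Arguments.
Unset Strict Implicit.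
Unset Printing Implicit Defensive.

Import Order.TTheory GRing.Theory Num.Theory.
Import numFieldNormedType.Exports.

Local Open Scope classical_set_scope.
Local Open Scope ring_scope.

(* A homeomorphism between an open subset of [F] and an open subset of the
   plane. [chart_map] and [chart_inv] are total, but their values outside
   [chart_dom] and [chart_cod] are irrelevant. *)
Record chart (R : realType) (F : topologicalType) := Chart {
  chart_dom : set F;
  chart_cod : set (R * R);
  chart_map : F -> R * R;
  chart_inv : R * R -> F;
  open_chart_dom : open chart_dom;
  open_chart_cod : open chart_cod;
  chart_map_cod : forall x, chart_dom x -> chart_cod (chart_map x);
  chart_inv_dom : forall p, chart_cod p -> chart_dom (chart_inv p);
  chart_mapK : forall x, chart_dom x -> chart_inv (chart_map x) = x;
  chart_invK : forall p, chart_cod p -> chart_map (chart_inv p) = p;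
  chart_map_continuous : {in chart_dom, continuous chart_map};
  chart_inv_continuous : {in chart_cod, continuous chart_inv}
}.

Definition circle_point (R : realType) (p : R * R) (r t : R) : R * R :=
  (p.1 + r * cos t, p.2 + r * sin t).

(* [h] has local degree +1 at [p]: the image under [h] of every small enough
   counterclockwise circle around [p] winds exactly once, counterclockwise,
   around [h p]. The winding number is computed by a continuous determination
   [theta] of the angle along the image loop. *)
Definition orientation_preserving_at (R : realType) (h : R * R -> R * R)
    (p : R * R) : Prop :=
  \forall r \near (0 : R)^'+, exists theta : R -> R,
    [/\ {within `[0, 2 * pi], continuous theta},
        forall t : R, 0 <= t <= 2 * pi ->
          exists2 rho : R, 0 < rho &
            h (circle_point p r t) = circle_point (h p) rho (theta t)
      & theta (2 * pi) = theta 0 + 2 * pi].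

Definition atlas (R : realType) (F : topologicalType) (A : set (chart R F)) :
    Prop :=
  forall x, exists2 c, A c & chart_dom c x.

Definition oriented_atlas (R : realType) (F : topologicalType)
    (A : set (chart R F)) : Prop :=
  atlas A /\
  forall c c' x, A c -> A c' -> chart_dom c x -> chart_dom c' x ->
    orientation_preserving_at (chart_map c' \o chart_inv c) (chart_map c x).

Definition surface (R : realType) (F : topologicalType) : Prop :=
  [/\ hausdorff_space F, @second_countable F
    & exists A : set (chart R F), atlas A].

Definition orientable (R : realType) (F : topologicalType) : Prop :=
  exists A : set (chart R F), oriented_atlas A.

(* Charts take values in open subsets of the plane, so a [surface] has no
   boundary and "closed" amounts to compactness. *)
Definition closed_connected_orientable_surface (R : realType)
    (F : topologicalType) : Prop :=
  [/\ surface R F, compact [set: F], [set: F] !=set0, connected [set: F]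
    & orientable R F].

Definition homeomorphism (F : topologicalType) (f : F -> F) : Prop :=
  continuous f /\
  exists g : F -> F, [/\ continuous g, cancel f g & cancel g f].

Definition periodic_map (F : topologicalType) (f : F -> F) : Prop :=
  homeomorphism f /\ exists2 n : nat, (0 < n)%N & iter n f = id.

(* For a periodic map [f], whose inverse is a nonnegative power of [f], this is
   the cyclic group generated by [f] under composition. *)
Definition cyclic_group (F : Type) (f : F -> F) : set (F -> F) :=
  [set iter k f | k in [set: nat]].

Definition special_orthogonal (R : realType) (m : nat) : set 'M[R]_m :=
  [set A | A *m A^T = 1%:M /\ \det A = 1].

Definition embedding (S T : topologicalType) (e : S -> T) : Prop :=
  [/\ continuous e, injective e
    & forall U, open U -> exists2 V, open V & U = e @^-1` V].

(* Only the restriction of [rho] to [cyclic_group f] is relevant. *)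
Definition equivariant_embedding (R : realType) (m : nat) (F : topologicalType)
    (f : F -> F) (e : F -> 'cV[R]_m) : Prop :=
  embedding e /\
  exists rho : (F -> F) -> 'M[R]_m,
    [/\ forall g, cyclic_group f g -> special_orthogonal (rho g),
        forall g h, cyclic_group f g -> cyclic_group f h ->
          rho (g \o h) = rho g *m rho h
      & forall g, cyclic_group f g -> forall x, e (g x) = rho g *m e x].

(* Main.v *)
From HB Require Import structures.
Require Import Defs.
From mathcomp Require Import all_boot all_order all_algebra.
From mathcomp Require Import all_classical all_reals all_analysis.
From mathcomp Require Import ring lra.

(** The obstruction is a count of orbit lengths.  If [e] is injective and
    intertwines [f] with a matrix [M], a point of the surface whose [f]-orbit
    has exactly [2 ^ t] elements gives a vector fixed by [M ^ (2 ^ t)] but not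
    by [M ^ (2 ^ (t - 1))].  Orbits of lengths 1, 2, 4, ..., [2 ^ N] thus make
    the fixed spaces of the powers [M ^ (2 ^ t)] a strictly increasing chain,
    and [N <= m] ([linear_orbit_chain_le_dim]).  So one needs a surface with a
    periodic map that has orbits of all the lengths 1, 2, ..., [2 ^ m.+1].

    Such a surface is the real moment-angle manifold of the regular [k]-gon,
    with [k = 2 ^ m.+1].  Let [n_l] be the unit vector of angle [2 pi l / k].
    The polygon [P] is cut out by the affine inequalities [1 + n_l . p >= 0],
    and the surface consists of the [x] in [R ^ k] for which some [p] satisfies
    [x_l ^ 2 = 1 + n_l . p] for all [l].  Its points over [p] are the choices of
    signs of the square roots: [2 ^ k] copies of [P], reflected across the
    sides.  Rotating the polygon by one notch, the cyclic shift of the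
    coordinates acts on the surface.  Over the centre [p = 0] lie all the sign
    vectors, and a sign vector of smallest period [2 ^ t] has an orbit of that
    length.

    It remains to see that this is a closed connected orientable surface.
    It is a finite union of continuous images of the compact convex set [P]
    ([surf_compact]), and two copies of [P] whose signs differ in one place meet
    along a side ([surf_connected]).  Two independent normals [n_i], [n_j]
    determine [p] from [x_i ^ 2] and [x_j ^ 2]; hence, where the other
    coordinates do not vanish, [(x_i, x_j)] is a chart.  These charts cover
    because the lines [1 + n_l . p = 0] are tangent to the unit circle and at
    most two tangents pass through a point ([two_tangents]).  Crossing a
    side reverses the area form [da /\ db] of the plane of [p = (a, b)], so the
    surface is oriented by [da /\ db] times the product of all the coordinates.
    As [d(x_l ^ 2) = n_l . dp], this is a positive multiple of
    [dx_i /\ dx_j] times [n_i /\ n_j] and the product of the coordinates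
    other than [x_i] and [x_j].  The charts for which the last two factors have
    a positive product thus form an oriented atlas ([corner_atlas_oriented]).
    Passing from this infinitesimal statement to winding numbers is the task of
    [orientation_preserving_secant]. *)

Set Implicit Arguments.
Unset Strict Implicit.
Unset Printing Implicit Defensive.

Import Order.TTheory GRing.Theory Num.Theory.
Import numFieldNormedType.Exports.

Local Open Scope classical_set_scope.
Local Open Scope ring_scope.

(** * Orbit lengths of a linear action *)

(** Each point [x t.+1] has an orbit of length exactly [2 ^ t.+1].  The
    dimension of the space fixed by the [2 ^ t]-th power of [M] grows with [t],
    as [e (x t.+1)] is fixed by the [2 ^ t.+1]-th power and not by the
    [2 ^ t]-th one. *)
Lemma linear_orbit_chain_le_dim (K : fieldType) (m N : nat) (X : Type)
    (f : X -> X) (e : X -> 'cV[K]_m) (M : 'M[K]_m) (x : nat -> X) :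
    injective e -> (forall y, e (f y) = M *m e y) ->
    (forall t, (t <= N)%N -> iter (2 ^ t) f (x t) = x t) ->
    (forall t, (t < N)%N -> iter (2 ^ t) f (x t.+1) <> x t.+1) ->
  (N <= m)%N.
Proof.
move=> e_inj eM fix_x move_x.
pose A n := iter n (mulmx M) 1%:M.
have eA n y : e (iter n f y) = A n *m e y.
  elim: n => [|n IHn] /=; first by rewrite mul1mx.
  by rewrite eM IHn mulmxA.
have AD n n' : A (n + n')%N = A n *m A n'.
  by elim: n => [|n IHn] /=; rewrite ?mul1mx// IHn mulmxA.
(* The fixed space of [A (2 ^ t)], encoded as a space of row vectors. *)
pose V t := kermx (A (2 ^ t)%N - 1%:M)^T.
have fixE t (u : 'cV_m) : (u^T <= V t)%MS = (A (2 ^ t)%N *m u == u).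
  rewrite (sameP sub_kermxP eqP) -trmx_mul -[in LHS](inj_eq trmx_inj).
  by rewrite trmxK trmx0 mulmxBl mul1mx subr_eq0.
have chain t : (t < N)%N -> (\rank (V t) < \rank (V t.+1))%N.
  move=> tN; apply: rank_ltmx.
  rewrite ltmxE; apply/andP; split.
    apply/rV_subP => u; rewrite -[u]trmxK !fixE => /eqP Au.
    by rewrite expnS mul2n -addnn AD -mulmxA !Au.
  apply: contra_notN (move_x _ tN) => VV.
  apply: e_inj; rewrite eA; apply/eqP; rewrite -fixE.
  by apply: submx_trans VV; rewrite fixE -eA fix_x.
have rankV t : (t <= N)%N -> (t <= \rank (V t))%N.
  elim: t => // t IHt tN; apply: leq_ltn_trans (chain _ tN).
  by apply: IHt; exact: ltnW.
exact: leq_trans (rankV _ (leqnn N)) (rank_leq_col _).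
Qed.

(** * Local degree of a map with a continuous secant matrix *)

Section LocalDegree.
Variable R : realType.
Implicit Types (p q : R * R) (x y : R).

(** The principal argument on the plane cut along the negative half-axis, by the
    tangent half-angle formula; on that domain it is continuous. *)
Definition slit_arg x y : R := 2 * atan (y / (Num.sqrt (x ^+ 2 + y ^+ 2) + x)).

Lemma slit_modulus_gt0 x y :
  ~ (y = 0 /\ x <= 0) -> 0 < Num.sqrt (x ^+ 2 + y ^+ 2) + x.
Proof.
move=> slit; have [x0|x0] := ltP 0 x.
  by rewrite ltr_wpDl// sqrtr_ge0.
have y0 : y != 0 by apply/eqP => y0; apply: slit.
have y2 : 0 < y ^+ 2 by rewrite exprn_even_gt0.
rewrite -ltrBlDr sub0r -[ltLHS]ger0_norm ?oppr_ge0// -sqrtr_sqr sqrrN.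
by rewrite ltr_sqrt ?ltrDl// ltr_wpDl// sqr_ge0.
Qed.

Lemma slit_polar x y (s := Num.sqrt (x ^+ 2 + y ^+ 2)) : ~ (y = 0 /\ x <= 0) ->
  [/\ 0 < s, s * cos (slit_arg x y) = x & s * sin (slit_arg x y) = y].
Proof.
move=> slit; have den := slit_modulus_gt0 slit.
have s2 : s ^+ 2 = x ^+ 2 + y ^+ 2 by rewrite sqr_sqrtr// addr_ge0// sqr_ge0.
rewrite -/s in den *.
have s0 : 0 < s.
  rewrite lt_neqAle sqrtr_ge0 andbT; apply/eqP => s0.
  by apply: slit; move: den s2; rewrite -s0; split; nra.
set u := y / (s + x).
have uE : u * (s + x) = y by rewrite divfK// gt_eqF.
have u2 : 0 < 1 + u ^+ 2 by rewrite ltr_pwDl// sqr_ge0.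
have c0 : cos (atan u) != 0.
  by rewrite cos_atan invr_eq0 gt_eqF// sqrtr_gt0.
have c2 : cos (atan u) ^+ 2 * (1 + u ^+ 2) = 1.
  by rewrite cos_atan exprVn sqr_sqrtr ?ltW// mulVf// gt_eqF.
have sE : sin (atan u) = u * cos (atan u).
  by rewrite -{2}(atanK u) /tan divfK.
have sx0 : s + x != 0 by rewrite gt_eqF.
(* The half-angle identity [cos A = 2 cos ^ 2 (A / 2) - 1] with [cos A = x / s]. *)
have k : cos (atan u) ^+ 2 * (2 * s) = s + x.
  apply: (mulIf sx0); apply: (mulIf (lt0r_neq0 u2)).
  transitivity (cos (atan u) ^+ 2 * (1 + u ^+ 2) * (2 * s * (s + x))); first by ring.
  rewrite c2; transitivity ((s + x) ^+ 2 + (u * (s + x)) ^+ 2); last by ring.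
  by rewrite uE sqrrD s2; nra.
split=> //; rewrite /slit_arg -/s -/u mulr_natl.
  by rewrite cos_mulr2n; nra.
rewrite sin_mulr2n sE -[RHS]uE -k; ring.
Qed.

Lemma slit_arg_continuous (f g : R -> R) :
  continuous f -> continuous g -> (forall t, ~ (g t = 0 /\ f t <= 0)) ->
  continuous (fun t => slit_arg (f t) (g t)).
Proof.
move=> cf cg slit t; have den := slit_modulus_gt0 (slit t).
apply: cvgM; first exact: cvg_cst.
apply: continuous_comp; last exact: continuous_atan.
apply: cvgM; first exact: cg.
apply: cvgV; first by rewrite gt_eqF.
apply: cvgD; last exact: cf.
apply: continuous_comp; last exact: sqrt_continuous.
by apply: cvgD; apply: cvgM; (exact: cf || exact: cg).
Qed.

(** The eigenvalue is a root of the characteristic polynomial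
    [X ^ 2 - (a + d) X + (a d - b c)], which is positive on the nonpositive
    half-line. *)
Lemma positive_eigenvalue (a b c d x u v : R) : u ^+ 2 + v ^+ 2 = 1 ->
  a * u + b * v = x * u -> c * u + d * v = x * v ->
  0 < a + d -> 0 < a * d - b * c -> 0 < x.
Proof.
move=> uv e1 e2 tr det.
have k1 : (x ^+ 2 - x * (a + d) + (a * d - b * c)) * u = 0.
  transitivity ((d - x) * (a * u + b * v - x * u) - b * (c * u + d * v - x * v)).
    by ring.
  by rewrite e1 e2; ring.
have k2 : (x ^+ 2 - x * (a + d) + (a * d - b * c)) * v = 0.
  transitivity ((a - x) * (c * u + d * v - x * v) - c * (a * u + b * v - x * u)).
    by ring.
  by rewrite e1 e2; ring.
have k : x ^+ 2 - x * (a + d) + (a * d - b * c) = 0.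
  rewrite -[LHS]mulr1 -uv; move: k1 k2; move: (_ - _ + _) => w k1 k2.
  by rewrite mulrDr !expr2 !mulrA k1 k2 !mul0r addr0.
rewrite ltNge; apply/negP => x0; nra.
Qed.

(** The displayed quantity is the trace of the matrix turned by the angle
    [- phi].  The vector [(a + d, c - b)] is nonzero, since
    [(a + d) ^ 2 + (c - b) ^ 2] is the sum of the squares of the entries plus
    twice the determinant; so one of the four quarter turns will do. *)
Lemma rotation_positive_trace (a b c d : R) : 0 < a * d - b * c ->
  exists phi : R, 0 < cos phi * (a + d) + sin phi * (c - b).
Proof.
move=> det; have [pos|neg|zero] := ltrgtP (a + d) 0.
- by exists pi; rewrite cospi sinpi; lra.
- by exists 0; rewrite cos0 sin0; lra.
have [pos|neg|eq] := ltrgtP (c - b) 0.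
- by exists (- (pi / 2)); rewrite cosN sinN cos_pihalf sin_pihalf; lra.
- by exists (pi / 2); rewrite cos_pihalf sin_pihalf; lra.
by exfalso; nra.
Qed.

Lemma continuous_pair (T : topologicalType) (f g : T -> R) (t : T) :
  {for t, continuous f} -> {for t, continuous g} ->
  {for t, continuous (fun t => (f t, g t))}.
Proof. by move=> cf cg; exact: (cvg_pair cf cg). Qed.

Lemma circle_point_continuous p r : continuous (circle_point p r).
Proof.
move=> t; apply: (@continuous_pair _ (fun t => p.1 + r * cos t)
  (fun t => p.2 + r * sin t)); (apply: cvgD; first exact: cvg_cst);
  (apply: cvgM; first exact: cvg_cst); [exact: continuous_cos|exact: continuous_sin].
Qed.

Lemma circle_point_near p (U : set (R * R)) : nbhs p U ->
  \forall r \near (0 : R)^'+, forall t, U (circle_point p r t).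
Proof.
move=> /nbhs_ballP[e /= e0 eU]; near=> r => t; apply: eU.
have r0 : 0 < r by [].
have re : r < e by near: r; exact: nbhs_right_lt.
by split; rewrite /ball /= opprD addrA subrr sub0r normrN normrM gtr0_norm//;
  rewrite (le_lt_trans _ re)// ler_piMr ?cos_max ?sin_max ?ltW.
Unshelve. all: by end_near. Qed.

(** The hypotheses are Caratheodory's form of differentiability with a positive
    Jacobian.  Once turned by a suitable angle [- phi], the secant matrix has
    positive trace and determinant near [p], and so no eigenvalue in the
    nonpositive half-line.  For a small [w] the turned increment of [h] is then
    never a nonpositive multiple of [w], that is, [h (p + w) - h p] is [w],
    turned by [phi], times a complex number [z] off the negative half-axis.
    Along a circle of centre [p] the angle of the increment is [t + phi] plus
    the principal argument of [z], and the latter returns to its initial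
    value. *)
Lemma orientation_preserving_secant (h : R * R -> R * R) p (a b c d : R * R -> R) :
    {for p, continuous a} -> {for p, continuous b} ->
    {for p, continuous c} -> {for p, continuous d} ->
    (\forall q \near p, {for q, continuous h}) ->
    (\forall q \near p,
      (h q).1 - (h p).1 = a q * (q.1 - p.1) + b q * (q.2 - p.2)) ->
    (\forall q \near p,
      (h q).2 - (h p).2 = c q * (q.1 - p.1) + d q * (q.2 - p.2)) ->
    0 < a p * d p - b p * c p ->
  orientation_preserving_at h p.
Proof.
move=> ca cb cc cd ch h1 h2 /[dup] det0 /rotation_positive_trace[phi tr0].
have det : \forall q \near p, 0 < a q * d q - b q * c q.
  have cdet : a q * d q - b q * c q @[q --> p] --> a p * d p - b p * c p.
    by apply: cvgB; apply: cvgM.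
  exact: cvgr_gt cdet _ det0.
have tr : \forall q \near p, 0 < cos phi * (a q + d q) + sin phi * (c q - b q).
  have ctr : cos phi * (a q + d q) + sin phi * (c q - b q) @[q --> p] -->
      cos phi * (a p + d p) + sin phi * (c p - b p).
    by apply: cvgD; (apply: cvgM; first exact: cvg_cst);
      [apply: cvgD|apply: cvgB].
  exact: cvgr_gt ctr _ tr0.
near=> r.
have r0 : 0 < r by [].
have Hch : forall t, {for circle_point p r t, continuous h}.
  by near: r; exact: (circle_point_near ch).
have H1 : forall t, (h (circle_point p r t)).1 - (h p).1 =
    r * (a (circle_point p r t) * cos t + b (circle_point p r t) * sin t).
  suff : forall t, (h (circle_point p r t)).1 - (h p).1 =
     a (circle_point p r t) * ((circle_point p r t).1 - p.1)
     + b (circle_point p r t) * ((circle_point p r t).2 - p.2).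
    by move=> + t => ->; rewrite /circle_point /=; ring.
  by near: r; exact: (circle_point_near h1).
have H2 : forall t, (h (circle_point p r t)).2 - (h p).2 =
    r * (c (circle_point p r t) * cos t + d (circle_point p r t) * sin t).
  suff : forall t, (h (circle_point p r t)).2 - (h p).2 =
     c (circle_point p r t) * ((circle_point p r t).1 - p.1)
     + d (circle_point p r t) * ((circle_point p r t).2 - p.2).
    by move=> + t => ->; rewrite /circle_point /=; ring.
  by near: r; exact: (circle_point_near h2).
have Hdet : forall t, 0 < a (circle_point p r t) * d (circle_point p r t)
     - b (circle_point p r t) * c (circle_point p r t).
  by near: r; apply: (circle_point_near det).
have Htr : forall t, 0 < cos phi * (a (circle_point p r t) + d (circle_point p r t)) +
     sin phi * (c (circle_point p r t) - b (circle_point p r t)).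
  by near: r; apply: (circle_point_near tr).
pose D1 t := (h (circle_point p r t)).1 - (h p).1.
pose D2 t := (h (circle_point p r t)).2 - (h p).2.
(* [x] and [y] are the real and imaginary parts of [r z]. *)
pose x t := cos (phi + t) * D1 t + sin (phi + t) * D2 t.
pose y t := cos (phi + t) * D2 t - sin (phi + t) * D1 t.
have slit t : ~ (y t = 0 /\ x t <= 0).
  move=> [yt xt]; set q := circle_point p r t in H1 H2 Hdet Htr.
  have e1 : x t * cos (phi + t) = D1 t.
    transitivity (D1 t * (cos (phi + t) ^+ 2 + sin (phi + t) ^+ 2)
        + sin (phi + t) * y t); first by rewrite /x /y; ring.
    by rewrite cos2Dsin2 yt mulr0 addr0 mulr1.
  have e2 : x t * sin (phi + t) = D2 t.
    transitivity (D2 t * (cos (phi + t) ^+ 2 + sin (phi + t) ^+ 2)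
        - cos (phi + t) * y t); first by rewrite /x /y; ring.
    by rewrite cos2Dsin2 yt mulr0 subr0 mulr1.
  have f1 : cos phi * D1 t + sin phi * D2 t = x t * cos t.
    rewrite -e1 -e2 cosD sinD -[in RHS](mul1r (cos t)) -(cos2Dsin2 phi); ring.
  have f2 : cos phi * D2 t - sin phi * D1 t = x t * sin t.
    rewrite -e1 -e2 cosD sinD -[in RHS](mul1r (sin t)) -(cos2Dsin2 phi); ring.
  have r1 : r^-1 * r = 1 by rewrite mulVf// gt_eqF.
  move: xt; apply/negP; rewrite -ltNge -(pmulr_rgt0 _ (_ : 0 < r^-1)) ?invr_gt0//.
  apply: (@positive_eigenvalue (cos phi * a q + sin phi * c q)
     (cos phi * b q + sin phi * d q) (cos phi * c q - sin phi * a q)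
     (cos phi * d q - sin phi * b q) _ (cos t) (sin t)).
  - exact: cos2Dsin2.
  - rewrite -mulrA -f1 /D1 /D2 H1 H2 -/q -[LHS]mul1r -r1; ring.
  - rewrite -mulrA -f2 /D1 /D2 H1 H2 -/q -[LHS]mul1r -r1; ring.
  - by have := Htr t; rewrite -/q; congr (0 < _); ring.
  - have := Hdet t; rewrite -/q -[X in 0 < X -> _]mul1r -(cos2Dsin2 phi).
    by congr (0 < _); ring.
have cD : continuous (fun t => h (circle_point p r t)).
  by move=> t; apply: continuous_comp; [exact: circle_point_continuous|exact: Hch].
have cD1 : continuous D1.
  move=> t; apply: cvgB; last exact: cvg_cst.
  by apply: continuous_comp; [exact: cD|exact: cvg_fst].
have cD2 : continuous D2.
  move=> t; apply: cvgB; last exact: cvg_cst.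
  by apply: continuous_comp; [exact: cD|exact: cvg_snd].
have cphi : continuous (fun t => cos (phi + t)).
  move=> t; apply: continuous_comp; last exact: continuous_cos.
  by apply: cvgD; [exact: cvg_cst|exact: cvg_id].
have sphi : continuous (fun t => sin (phi + t)).
  move=> t; apply: continuous_comp; last exact: continuous_sin.
  by apply: cvgD; [exact: cvg_cst|exact: cvg_id].
have cx : continuous x.
  by move=> t; apply: cvgD; apply: cvgM; [exact: cphi|exact: cD1|exact: sphi|exact: cD2].
have cy : continuous y.
  by move=> t; apply: cvgB; apply: cvgM; [exact: cphi|exact: cD2|exact: sphi|exact: cD1].
exists (fun t => (phi + t) + slit_arg (x t) (y t)); split.
- apply: continuous_subspaceT => t; apply: cvgD.
    by apply: cvgD; [exact: cvg_cst|exact: cvg_id].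
  exact: slit_arg_continuous.
- move=> t _; have [s0 sx sy] := slit_polar (slit t).
  exists (Num.sqrt (x t ^+ 2 + y t ^+ 2)) => //.
  set s := Num.sqrt _ in s0 sx sy *; set A := slit_arg _ _ in sx sy *.
  have e1 : s * (cos (phi + t) * cos A - sin (phi + t) * sin A) = D1 t.
    transitivity (cos (phi + t) * x t - sin (phi + t) * y t).
      by rewrite -sx -sy; ring.
    by rewrite -[RHS]mul1r -(cos2Dsin2 (phi + t)) /x /y; ring.
  have e2 : s * (sin (phi + t) * cos A + cos (phi + t) * sin A) = D2 t.
    transitivity (sin (phi + t) * x t + cos (phi + t) * y t).
      by rewrite -sx -sy; ring.
    by rewrite -[RHS]mul1r -(cos2Dsin2 (phi + t)) /x /y; ring.
  transitivity ((h p).1 + D1 t, (h p).2 + D2 t).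
    by rewrite /D1 /D2 !subrKC -surjective_pairing.
  by rewrite -e1 -e2 /circle_point (cosD (phi + t)) (sinD (phi + t)).
- have per : circle_point p r (2 * pi) = circle_point p r 0.
    by rewrite /circle_point mulr_natl cos2pi sin2pi cos0 sin0.
  have -> : x (2 * pi) = x 0.
    by rewrite /x /D1 /D2 per mulr_natl cosD2pi sinD2pi addr0.
  have -> : y (2 * pi) = y 0.
    by rewrite /y /D1 /D2 per mulr_natl cosD2pi sinD2pi addr0.
  by ring.
Unshelve. all: by end_near. Qed.

End LocalDegree.

(** * The moment-angle surface of a polygon *)

Section RowTopology.
Variables (R : realType) (k : nat) (T : topologicalType).

Lemma continuous_row (g : T -> 'rV[R]_k) (x : T) :
  (forall l, {for x, continuous (fun y => g y 0 l)}) -> {for x, continuous g}.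
Proof.
move=> cg A [P gP PA]; have : \forall y \near x, forall i j, P i j (g y i j).
  by apply: filter_forall => i; apply: filter_forall => j; rewrite (ord1 i);
    apply: cg; rewrite -(ord1 i); exact: gP.
by apply: filterS => y Py; apply: PA.
Qed.

End RowTopology.

Section MomentAngle.
Variables (R : realType) (k : nat) (nrm : 'I_k -> R * R).
Implicit Types (i j l : 'I_k) (p q : R * R).

Definition side l p : R := 1 + ((nrm l).1 * p.1 + (nrm l).2 * p.2).

(** The real moment-angle set of the polygon with inner normals [nrm]: the
    coordinates are signed square roots of the equations of the sides. *)
Definition moment_angle : set 'rV[R]_k :=
  [set x | exists p, forall l, x 0 l ^+ 2 = side l p].

Definition surf : Type := set_type moment_angle.

HB.instance Definition _ := SubChoice.on surf.
HB.instance Definition _ := PseudoMetric.copy surf (set_type moment_angle).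

(** A point over the centre of the polygon; it is the default value of [to_surf]. *)
Definition base_point : surf.
Proof.
exists (const_mx 1); rewrite inE; exists (0, 0) => l.
by rewrite mxE /side /=; ring.
Defined.

HB.instance Definition _ := isPointed.Build surf base_point.

Definition crd l (x : surf) : R := (val x) 0 l.

Lemma val_continuous : continuous (val : surf -> 'rV[R]_k).
Proof. exact: initial_continuous. Qed.

Lemma crd_continuous l : continuous (crd l).
Proof.
move=> x; apply: (@continuous_comp _ _ _ _ (fun v : 'rV[R]_k => v 0 l)).
  exact: val_continuous.
exact: coord_continuous.
Qed.

Lemma crdP (x : surf) : exists p, forall l, crd l x ^+ 2 = side l p.
Proof. by case: x => v vM; exact: (set_mem vM). Qed.

Lemma crd_inj (x y : surf) : (forall l, crd l x = crd l y) -> x = y.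
Proof. by move=> xy; apply: val_inj; apply/rowP. Qed.

Definition to_surf (v : 'rV[R]_k) : surf := insubd base_point v.

Lemma to_surfK v : moment_angle v -> val (to_surf v) = v.
Proof. by move=> ?; rewrite insubdK// inE. Qed.

Lemma to_surf_continuous (T : topologicalType) (A : set T) (g : T -> 'rV[R]_k) :
  continuous g -> (forall x, A x -> moment_angle (g x)) ->
  {within A, continuous (to_surf \o g)}.
Proof.
move=> cg Ag; apply: (@continuous_comp_initial surf (subspace A) _ val).
apply: (@subspace_eq_continuous _ _ _ g).
  by move=> x; rewrite inE => Ax /=; rewrite to_surfK//; exact: Ag.
exact: continuous_subspaceT.
Qed.

Lemma surf_hausdorff : hausdorff_space surf.
Proof.
move=> x y xy; apply: crd_inj => l; apply: Rhausdorff => A B xA yB.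
have [z [zA zB]] := xy _ _ (crd_continuous xA) (crd_continuous yB).
by exists (crd l z).
Qed.

Definition polygon : set (R * R) := [set p | forall l, 0 <= side l p].

Lemma side_continuous l : continuous (side l).
Proof.
move=> p; apply: cvgD; first exact: cvg_cst.
by apply: cvgD; (apply: cvgM; first exact: cvg_cst); [exact: cvg_fst|exact: cvg_snd].
Qed.

Definition sgn (s : {ffun 'I_k -> bool}) l : R := (-1) ^+ s l.

Definition lift_row (s : {ffun 'I_k -> bool}) p : 'rV[R]_k :=
  \row_l (sgn s l * Num.sqrt (side l p)).

Lemma lift_row_continuous s : continuous (lift_row s).
Proof.
move=> p; apply: continuous_row => l.
rewrite (_ : (fun _ => _) = fun q => sgn s l * Num.sqrt (side l q)); last first.
  by apply/funext => q; rewrite mxE.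
apply: cvgM; first exact: cvg_cst.
by apply: continuous_comp; [exact: side_continuous|exact: sqrt_continuous].
Qed.

Lemma lift_row_moment_angle s p : polygon p -> moment_angle (lift_row s p).
Proof.
by move=> pP; exists p => l; rewrite mxE exprMn sqr_sqrtr// sqrr_sign mul1r.
Qed.

(** The copy of the polygon on which the coordinates have the signs [s]; it
    contains the points of its sides, where the sign of a coordinate is
    ambiguous. *)
Definition sheet s : set surf := (to_surf \o lift_row s) @` polygon.

Lemma sheetP s (x : surf) : (forall l, 0 <= sgn s l * crd l x) -> sheet s x.
Proof.
move=> sx; have [p xp] := crdP x.
have pP : polygon p by move=> l; rewrite -xp sqr_ge0.
exists p => //; apply: crd_inj => l.
rewrite /crd /= to_surfK; last exact: lift_row_moment_angle.
rewrite mxE -xp sqrtr_sqr -[`|_|]mul1r -{1}(normr_sign R (s l)) -normrM.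
by rewrite ger0_norm ?sx// /sgn mulrA -expr2 sqrr_sign mul1r.
Qed.

Definition signs (x : surf) : {ffun 'I_k -> bool} := [ffun l => crd l x < 0].

Lemma signsP x l : 0 <= sgn (signs x) l * crd l x.
Proof.
rewrite /sgn ffunE; case: ltP => x0 /=; last by rewrite expr0 mul1r.
by rewrite expr1 mulN1r oppr_ge0 ltW.
Qed.

Lemma sheet_cover : [set: surf] = \bigcup_(s in [set: {ffun 'I_k -> bool}]) sheet s.
Proof.
rewrite eqEsubset; split=> // x _; exists (signs x) => //.
exact/sheetP/signsP.
Qed.

Hypothesis nrm_unit : forall l, (nrm l).1 ^+ 2 + (nrm l).2 ^+ 2 = 1.
Hypothesis nrm_quarter : forall l, exists l', nrm l' = (- (nrm l).2, (nrm l).1).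
Variable l0 : 'I_k.

(** Boundedness comes from four normals that differ by quarter turns: they
    confine [p] to a turned square of half-side 1, hence to the square of
    half-side 2 with sides parallel to the axes. *)
Lemma polygon_compact : compact polygon.
Proof.
have box : compact ((`[-2, 2]%classic `*` `[-2, 2]%classic) : set (R * R)).
  by apply: compact_setX; exact: segment_compact.
apply: subclosed_compact box _.
- rewrite (_ : polygon = \bigcap_(l in setT) (side l @^-1` [set x | 0 <= x])).
    apply: closed_bigI => l _; apply: preimage_closed; last exact: closed_ge.
    by move=> p _; exact: side_continuous.
  by rewrite eqEsubset; split=> [p pP l _|p pP l]; [exact: pP|exact: (pP l)].
- move=> p pP; have [l1 n1] := nrm_quarter l0.
  have [l2 n2] := nrm_quarter l1; have [l3 n3] := nrm_quarter l2.
  have u := nrm_unit l0.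
  have := pP l0; have := pP l1; have := pP l2; have := pP l3.
  rewrite /side n3 n2 n1 /=; set a := (nrm l0).1 in u *; set b := (nrm l0).2 in u *.
  move=> h3 h2 h1 h0.
  have ab : (a * p.1 + b * p.2) ^+ 2 + (a * p.2 - b * p.1) ^+ 2 <= 2.
    rewrite (_ : 2 = 1 + 1)//; apply: lerD; rewrite expr2; nra.
  have pp : p.1 ^+ 2 + p.2 ^+ 2 <= 2.
    apply: le_trans ab; rewrite -[leLHS]mul1r -[X in X * _]u.
    by rewrite le_eqVlt; apply/orP; left; apply/eqP; ring.
  by split; rewrite /= in_itv /=; apply/andP; split; nra.
Qed.

Lemma surf_compact : compact [set: surf].
Proof.
rewrite sheet_cover (_ : \bigcup_(s in _) _ =
    \big[setU/set0]_(s <- enum {ffun 'I_k -> bool}) sheet s).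
  apply: bigsetU_compact => s _; apply: continuous_compact polygon_compact.
  by apply: to_surf_continuous; [exact: lift_row_continuous|exact: lift_row_moment_angle].
rewrite -bigcup_seq; apply: eq_bigcupl.
by split=> // s _ /=; rewrite mem_enum.
Qed.

Lemma polygon_connected : connected polygon.
Proof.
have polygon0 : polygon (0, 0) by move=> l; rewrite /side /=; lra.
pose ray p := (fun t : R => (t * p.1, t * p.2)) @` `[0, 1].
have -> : polygon = \bigcup_(p in polygon) ray p.
  rewrite eqEsubset; split=> [p pP|_ [p pP [t t01 <-]] l].
    exists p => //; exists 1; first by rewrite /= in_itv /= ler01 lexx.
    by rewrite !mul1r -surjective_pairing.
  move: t01; rewrite /= in_itv /= => /andP[t0 t1]; have := pP l.
  rewrite /side /= => s0; nra.
apply: bigcup_connected.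
  by exists (0, 0) => p pP; exists 0; rewrite /= ?in_itv /= ?lexx ?ler01 ?mul0r.
move=> p _; apply: connected_continuous_connected; first exact: segment_connected.
apply: continuous_subspaceT => t.
have lin (c : R) : {for t, continuous (fun t : R => t * c)}.
  by apply: cvgM; [exact: cvg_id|exact: cvg_cst].
exact: (continuous_pair (lin p.1) (lin p.2)).
Qed.

Lemma sheet_connected s : connected (sheet s).
Proof.
apply: connected_continuous_connected; first exact: polygon_connected.
by apply: to_surf_continuous; [exact: lift_row_continuous|exact: lift_row_moment_angle].
Qed.

(** The foot of the perpendicular from the centre lies on the boundary of the
    polygon: by Cauchy-Schwarz [- n_l] satisfies all the inequalities, and
    that of the side [l] is an equality. *)
Lemma side_touch l : polygon (- (nrm l).1, - (nrm l).2) /\ side l (- (nrm l).1, - (nrm l).2) = 0.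
Proof.
have ul := nrm_unit l; split; last by rewrite /side /=; lra.
move=> i; have ui := nrm_unit i; rewrite /side /=.
have := sqr_ge0 ((nrm i).1 - (nrm l).1).
have := sqr_ge0 ((nrm i).2 - (nrm l).2).
rewrite !sqrrB; lra.
Qed.

Definition flip (s : {ffun 'I_k -> bool}) l : {ffun 'I_k -> bool} :=
  [ffun i => if i == l then false else s i].

Lemma sheet_flip s l : sheet s `&` sheet (flip s l) !=set0.
Proof.
have [pP pl] := side_touch l; set p := (_, _) in pP pl.
exists (to_surf (lift_row s p)); split; first by exists p.
exists p => //=; congr to_surf; apply/rowP => i; rewrite !mxE /sgn ffunE.
by case: (eqVneq i l) => // ->; rewrite pl sqrtr0 !mulr0.
Qed.

(** Changing the negative signs of a sheet to positive ones, one at a time,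
    gives a chain of sheets that ends with the positive one, and consecutive
    sheets meet on a side. *)
Lemma surf_connected : connected [set: surf].
Proof.
pose s0 : {ffun 'I_k -> bool} := [ffun=> false].
have chain n (s : {ffun 'I_k -> bool}) : (#|[set l | s l]%SET| <= n)%N ->
    exists A : set surf, [/\ connected A, sheet s0 `<=` A & sheet s `<=` A].
  elim: n s => [|n IHn] s sn.
    suff -> : s = s0 by exists (sheet s0); split=> //; exact: sheet_connected.
    apply/ffunP => l; rewrite ffunE; apply/negbTE.
    move: sn; rewrite leqn0 cards_eq0 => /eqP/setP/(_ l).
    by rewrite !inE => ->.
  have [[l sl]|none] := pselect (exists l, s l); last first.
    apply: IHn; rewrite (_ : finset _ = finset.set0) ?cards0//.
    by apply/setP => l; rewrite !inE; apply/negP => sl; apply: none; exists l.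
  have [|A [cA As0 As]] := IHn (flip s l).
    rewrite -ltnS (leq_trans _ sn)// proper_card//; apply/properP; split.
      by apply/fintype.subsetP => i; rewrite !inE ffunE; case: ifP.
    by exists l; rewrite !inE ?sl// ffunE eqxx.
  exists (A `|` sheet s); split; last by [].
    apply: connectedU => //; last exact: sheet_connected.
    by have [x [x1 x2]] := sheet_flip s l; exists x; split=> //; exact: As.
  by apply: subset_trans As0 _.
pose ch s := cid (chain _ s (leqnn _)).
rewrite (_ : setT = \bigcup_(s in [set: {ffun 'I_k -> bool}]) projT1 (ch s)).
  apply: bigcup_connected => [|s _].
    exists (to_surf (lift_row s0 (0, 0))) => s _.
    have [_ + _] := projT2 (ch s); apply; exists (0, 0) => // l.
    by rewrite /side /=; lra.
  by have [] := projT2 (ch s).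
rewrite eqEsubset; split=> // x _; exists (signs x) => //.
have [_ _] := projT2 (ch (signs x)); apply.
exact/sheetP/signsP.
Qed.

End MomentAngle.

(** * Charts by two coordinates *)

Section Charts.
Variables (R : realType) (k : nat) (nrm : 'I_k -> R * R).
Implicit Types (i j l : 'I_k) (p q : R * R) (s : {ffun 'I_k -> bool}).
Local Notation surf := (surf nrm).
Local Notation side := (side nrm).

Definition wedge i j : R := (nrm i).1 * (nrm j).2 - (nrm i).2 * (nrm j).1.

Lemma wedgexx i : wedge i i = 0.
Proof. by rewrite /wedge; ring. Qed.

Lemma wedgeC i j : wedge j i = - wedge i j.
Proof. by rewrite /wedge; ring. Qed.

Lemma wedge_neq i j : wedge i j != 0 -> i != j.
Proof. by apply: contraNneq => ->; rewrite wedgexx. Qed.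

(** The equation of the side [l] at the point of the plane where the equations
    of the sides [i] and [j] take the values [q.1 ^ 2] and [q.2 ^ 2].  The two
    quotients are the coordinates of [n_l] in the basis [(n_i, n_j)]. *)
Definition side_of i j l q : R :=
  1 + (wedge l j / wedge i j * (q.1 ^+ 2 - 1) + wedge i l / wedge i j * (q.2 ^+ 2 - 1)).

Lemma side_of_side i j q : wedge i j != 0 ->
  exists p, forall l, side l p = side_of i j l q.
Proof.
move=> w; pose U := q.1 ^+ 2 - 1; pose V := q.2 ^+ 2 - 1.
exists ((U * (nrm j).2 - V * (nrm i).2) / wedge i j,
        (V * (nrm i).1 - U * (nrm j).1) / wedge i j) => l.
by move: w; rewrite /side_of -/U -/V /side /wedge /= => w; field.
Qed.

Lemma side_of_crd i j (x : surf) l : wedge i j != 0 ->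
  side_of i j l (crd i x, crd j x) = crd l x ^+ 2.
Proof.
move=> w; have [p xp] := crdP x; rewrite /side_of /= !xp /side.
by move: w; rewrite /wedge => w; field.
Qed.

Lemma side_of1 i j q : wedge i j != 0 -> side_of i j i q = q.1 ^+ 2.
Proof. by move=> w; rewrite /side_of wedgexx; field. Qed.

Lemma side_of2 i j q : wedge i j != 0 -> side_of i j j q = q.2 ^+ 2.
Proof. by move=> w; rewrite /side_of wedgexx; field. Qed.

Lemma side_of_continuous i j l : continuous (side_of i j l).
Proof.
move=> q; apply: cvgD; first exact: cvg_cst.
by apply: cvgD; (apply: cvgM; first exact: cvg_cst);
  (apply: cvgB; last exact: cvg_cst); apply: cvgM; (exact: cvg_fst || exact: cvg_snd).
Qed.

Definition chart_row i j s q : 'rV[R]_k :=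
  \row_l if l == i then q.1 else if l == j then q.2
         else sgn R s l * Num.sqrt (side_of i j l q).

Lemma chart_row_continuous i j s : continuous (chart_row i j s).
Proof.
move=> q; apply: continuous_row => l; rewrite /chart_row.
rewrite (_ : (fun _ => _) = fun q => if l == i then q.1 else if l == j then q.2
         else sgn R s l * Num.sqrt (side_of i j l q)); last first.
  by apply/funext => q'; rewrite mxE.
case: eqP => _; first exact: cvg_fst.
case: eqP => _; first exact: cvg_snd.
apply: cvgM; first exact: cvg_cst.
by apply: continuous_comp; [exact: side_of_continuous|exact: sqrt_continuous].
Qed.

Definition corner_dom i j s : set surf :=
  [set x | forall l, l != i -> l != j -> 0 < sgn R s l * crd l x].

Definition corner_cod i j : set (R * R) :=
  [set q | forall l, l != i -> l != j -> 0 < side_of i j l q].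

Lemma continuous_scale (T : topologicalType) (c : R) (g : T -> R) :
  continuous g -> continuous (fun x => c * g x).
Proof. by move=> cg x; apply: cvgM; [exact: cvg_cst|exact: cg]. Qed.

Lemma open_forall_gt0 (T : topologicalType) (a b : 'I_k) (g : 'I_k -> T -> R) :
  (forall l, continuous (g l)) ->
  open [set x | forall l, l != a -> l != b -> 0 < g l x].
Proof.
move=> cg; rewrite openE => x gx; rewrite /interior /=.
suff : \forall y \near x, forall l, (l != a) && (l != b) ==> (0 < g l y).
  by apply: filterS => y gy l la lb; have := gy l; rewrite la lb.
apply: filter_forall => l; case: (boolP (_ && _)) => [/andP[la lb]|_] /=.
  exact: (cvgr_gt _ (cg l x) _ (gx _ la lb)).
by apply: nearW.
Qed.

Lemma open_corner_dom i j s : open (corner_dom i j s).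
Proof.
apply: (@open_forall_gt0 _ _ _ (fun l x => sgn R s l * crd l x)) => l.
exact: continuous_scale (@crd_continuous _ _ nrm l).
Qed.

Lemma open_corner_cod i j : open (corner_cod i j).
Proof. exact: open_forall_gt0 (@side_of_continuous i j). Qed.

Section OneChart.
Variables (i j : 'I_k) (s : {ffun 'I_k -> bool}) (w : wedge i j != 0).

Lemma chart_row_moment_angle q :
  corner_cod i j q -> moment_angle nrm (chart_row i j s q).
Proof.
move=> qc; have [p pq] := side_of_side q w; exists p => l; rewrite pq mxE.
case: eqVneq => [->|li]; first by rewrite side_of1.
case: eqVneq => [->|lj]; first by rewrite side_of2.
by rewrite exprMn sqrr_sign mul1r sqr_sqrtr// ltW// qc.
Qed.

Definition corner_map (x : surf) : R * R := (crd i x, crd j x).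
Definition corner_inv (q : R * R) : surf := to_surf nrm (chart_row i j s q).

Lemma crd_corner_inv l q : corner_cod i j q ->
  crd l (corner_inv q) = chart_row i j s q 0 l.
Proof. by move=> qc; rewrite /crd to_surfK//; exact: chart_row_moment_angle. Qed.

Lemma corner_map_cod x : corner_dom i j s x -> corner_cod i j (corner_map x).
Proof.
move=> xd l li lj; rewrite side_of_crd// exprn_even_gt0//=.
by have := xd l li lj; apply: contraTneq => ->; rewrite mulr0 ltxx.
Qed.

Lemma corner_inv_dom q : corner_cod i j q -> corner_dom i j s (corner_inv q).
Proof.
move=> qc l li lj; rewrite crd_corner_inv// mxE (negbTE li) (negbTE lj).
by rewrite mulrA -expr2 sqrr_sign mul1r sqrtr_gt0 qc.
Qed.

Lemma corner_mapK x : corner_dom i j s x -> corner_inv (corner_map x) = x.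
Proof.
move=> xd; apply: crd_inj => l; rewrite crd_corner_inv; last exact: corner_map_cod.
rewrite mxE; case: eqVneq => [->//|li]; case: eqVneq => [->//|lj].
rewrite side_of_crd// sqrtr_sqr -[`|_|]mul1r -(normr_sign R (s l)) -normrM.
by rewrite ger0_norm ?mulrA -?expr2 ?sqrr_sign ?mul1r// ltW// xd.
Qed.

Lemma corner_invK q : corner_cod i j q -> corner_map (corner_inv q) = q.
Proof.
move=> qc; rewrite /corner_map !crd_corner_inv// !mxE !eqxx.
by rewrite eq_sym (negbTE (wedge_neq w)) -surjective_pairing.
Qed.

Lemma corner_map_continuous : continuous corner_map.
Proof.
move=> x; exact: (continuous_pair (@crd_continuous _ _ _ i x)
  (@crd_continuous _ _ _ j x)).
Qed.

Lemma corner_inv_continuous : {in corner_cod i j, continuous corner_inv}.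
Proof.
rewrite -continuous_open_subspace; last exact: open_corner_cod.
by apply: to_surf_continuous; [exact: chart_row_continuous|exact: chart_row_moment_angle].
Qed.

Definition corner_chart : chart R surf :=
  @Chart R surf (corner_dom i j s) (corner_cod i j) corner_map corner_inv
    (@open_corner_dom i j s) (@open_corner_cod i j)
    corner_map_cod corner_inv_dom corner_mapK corner_invK
    (fun x _ => @corner_map_continuous x) corner_inv_continuous.

End OneChart.

(** * Orientation of the charts *)

(** The partial derivatives of the [l]-th coordinate with respect to the [i]-th
    and the [j]-th one, obtained by differentiating
    [x_l ^ 2 = side_of i j l (x_i, x_j)]. *)
Definition slope1 i j l (x : 'I_k -> R) : R :=
  if l == i then 1 else if l == j then 0
  else wedge l j / wedge i j * (x i / x l).

Definition slope2 i j l (x : 'I_k -> R) : R :=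
  if l == i then 0 else if l == j then 1
  else wedge i l / wedge i j * (x j / x l).

(** A difference of square roots is the difference of the radicands over the sum
    of the roots; the radicand of [x_l] is affine in [q.1 ^ 2] and [q.2 ^ 2]. *)
Lemma chart_row_secant i j s l q0 (x := fun l => chart_row i j s q0 0 l) :
    wedge i j != 0 -> corner_cod i j q0 ->
  exists a b : R * R -> R, [/\ {for q0, continuous a}, {for q0, continuous b},
    a q0 = slope1 i j l x, b q0 = slope2 i j l x &
    forall q, corner_cod i j q ->
      chart_row i j s q 0 l - chart_row i j s q0 0 l =
      a q * (q.1 - q0.1) + b q * (q.2 - q0.2)].
Proof.
move=> w q0c; rewrite /slope1 /slope2.
case: (eqVneq l i) => [->|li].
  exists (cst 1), (cst 0); split=> //; try exact: cvg_cst.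
  by move=> q _; rewrite !mxE eqxx /=; ring.
case: (eqVneq l j) => [lj|lj].
  exists (cst 0), (cst 1); split=> //; try exact: cvg_cst.
  by move=> q _; rewrite !mxE (negbTE li) lj eqxx /=; ring.
pose r q := Num.sqrt (side_of i j l q).
have r_gt0 q : corner_cod i j q -> 0 < r q by move=> qc; rewrite sqrtr_gt0 qc.
have rsum q : corner_cod i j q -> r q + r q0 != 0.
  by move=> qc; rewrite gt_eqF// addr_gt0 ?r_gt0.
have cr : {for q0, continuous r}.
  by apply: continuous_comp; [exact: side_of_continuous|exact: sqrt_continuous].
have cden : {for q0, continuous (fun q => (sgn R s l * (r q + r q0))^-1)}.
  apply: cvgV; first by rewrite mulf_neq0 ?signr_eq0 ?rsum.
  apply: cvgM; first exact: cvg_cst.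
  by apply: cvgD; [exact: cr|exact: cvg_cst].
have sx : sgn R s l ^+ 2 = 1 by rewrite sqrr_sign.
have s0 : sgn R s l != 0 by rewrite signr_eq0.
have r0 : r q0 != 0 by rewrite gt_eqF ?r_gt0.
exists (fun q => wedge l j / wedge i j * ((q.1 + q0.1) / (sgn R s l * (r q + r q0)))).
exists (fun q => wedge i l / wedge i j * ((q.2 + q0.2) / (sgn R s l * (r q + r q0)))).
split.
- apply: cvgM; first exact: cvg_cst.
  apply: cvgM; last exact: cden.
  by apply: cvgD; [exact: cvg_fst|exact: cvg_cst].
- apply: cvgM; first exact: cvg_cst.
  apply: cvgM; last exact: cden.
  by apply: cvgD; [exact: cvg_snd|exact: cvg_cst].
- rewrite /x !mxE eqxx (negbTE li) (negbTE lj) -/(r q0).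
  by field; rewrite r0 s0 w -mulr2n mulrn_eq0.
- rewrite /x !mxE eqxx (negbTE li) (negbTE lj) -/(r q0) eq_sym (negbTE (wedge_neq w)).
  by field; rewrite r0 s0 w -mulr2n mulrn_eq0.
move=> q qc; rewrite !mxE (negbTE li) (negbTE lj) -/(r q) -/(r q0).
have e : r q ^+ 2 - r q0 ^+ 2 = wedge l j / wedge i j * (q.1 ^+ 2 - q0.1 ^+ 2)
    + wedge i l / wedge i j * (q.2 ^+ 2 - q0.2 ^+ 2).
  rewrite !sqr_sqrtr ?(ltW (qc _ _ _)) ?(ltW (q0c _ _ _))// /side_of; ring.
have den0 := rsum q qc.
apply: (mulfI (mulf_neq0 s0 den0)).
transitivity (sgn R s l ^+ 2 * (r q ^+ 2 - r q0 ^+ 2)); first by ring.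
rewrite sx mul1r e; field.
by rewrite den0 s0 w.
Qed.

(** Its sign compares the area form [dx_i /\ dx_j] with a fixed orientation of
    the surface: where no coordinate vanishes, [x_i x_j dx_i /\ dx_j] is
    [wedge i j] times a quarter of the area form of the plane of the polygon, and
    the sheets are oriented alternately, by the sign of the product of all the
    coordinates. *)
Definition area_sign i j (x : 'I_k -> R) : R :=
  wedge i j * \prod_(l | (l != i) && (l != j)) x l.

(** The Jacobian of the change of coordinates from [(x_i, x_j)] to
    [(x_i', x_j')] is [area_sign i' j' x / area_sign i j x].  When the two pairs
    have no common index, all four coordinates are nonzero and this is a
    Plucker relation for [wedge]; otherwise a row of the Jacobian matrix is a
    unit vector, which allows the common coordinate to vanish. *)
Lemma slope_det_gt0 i j i' j' (x : 'I_k -> R) :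
    0 < area_sign i j x -> 0 < area_sign i' j' x ->
  0 < slope1 i j i' x * slope2 i j j' x - slope2 i j i' x * slope1 i j j' x.
Proof.
(* [P] is the product of the coordinates that both area signs involve. *)
have key (w w' y z P : R) : 0 < w * (y * P) -> 0 < w' * (z * P) ->
    0 < w' / w * (z / y).
  move=> h h'; have w0 : w != 0.
    by apply: contraTneq h => ->; rewrite mul0r ltxx.
  have y0 : y != 0 by apply: contraTneq h => ->; rewrite mul0r mulr0 ltxx.
  have P0 : P != 0 by apply: contraTneq h => ->; rewrite !mulr0 ltxx.
  rewrite (_ : w' / w * (z / y) = (w * (y * P)) * (w' * (z * P)) / (w * y * P) ^+ 2).
    by apply: divr_gt0; [exact: mulr_gt0|rewrite exprn_even_gt0//= !mulf_neq0].
  by field; rewrite w0 y0 P0.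
have wN a b : 0 < area_sign a b x -> a != b.
  by apply: contraTneq => ->; rewrite /area_sign wedgexx mul0r ltxx.
have areaC a b : area_sign b a x = - area_sign a b x.
  rewrite /area_sign wedgeC mulNr; congr (- (_ * _)).
  by apply: eq_bigl => l; rewrite andbC.
have area3 a b c : a != b -> a != c -> b != c -> area_sign a b x =
   wedge a b * (x c * \prod_(l | [&& l != a, l != b & l != c]) x l).
  move=> ab ac bc; rewrite /area_sign (bigD1 c) ?(eq_sym c) ?ac ?bc//=.
  by congr (_ * (_ * _)); apply: eq_bigl => l; rewrite -andbA.
move=> h h'; have ij := wN _ _ h; have ij' := wN _ _ h'.
have ji : (j == i) = false by rewrite eq_sym (negbTE ij).
have w0 : wedge i j != 0 by apply: contraTneq h => e; rewrite /area_sign e mul0r ltxx.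
rewrite /slope1 /slope2.
have sym (a b : 'I_k) : a != b -> b != a by rewrite eq_sym.
case: (eqVneq i' i) => [ii|i'i].
  rewrite ii in h' ij' *; case: (eqVneq j' i) => [ji'|j'i].
    by rewrite ji' eqxx in ij'.
  rewrite mul1r mul0r subr0; case: (eqVneq j' j) => [//|j'j].
  rewrite (area3 i j j')// ?(sym j')// in h.
  rewrite (area3 i j' j)// ?(sym i j)// in h'.
  apply: key h _; move: h'; congr (0 < _ * (_ * _)).
  by apply: eq_bigl => l; do 3!case: (l == _).
case: (eqVneq i' j) => [ij''|i'j].
  rewrite ij'' in h' ij' *; rewrite mul0r mul1r sub0r.
  case: (eqVneq j' i) => [ji'|j'i].
    by move: h'; rewrite ji' areaC oppr_gt0 => /(lt_trans h); rewrite ltxx.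
  have jj' : (j' == j) = false by rewrite eq_sym (negbTE ij').
  rewrite jj' -mulNr -mulNr -wedgeC.
  rewrite (area3 i j j')// ?(sym j')// in h.
  rewrite (area3 j j' i)// ?ji// in h'.
  apply: key h _; move: h'; congr (0 < _ * (_ * _)).
  by apply: eq_bigl => l; do 3!case: (l == _).
case: (eqVneq j' i) => [ji'|j'i].
  rewrite ji' in h' ij' *.
  rewrite mulr0 mulr1 sub0r -mulNr -mulNr -wedgeC.
  rewrite (area3 i j i')// ?(sym i')// in h.
  rewrite (area3 i' i j)// in h'.
  apply: key h _; move: h'; congr (0 < _ * (_ * _)).
  by apply: eq_bigl => l; do 3!case: (l == _).
case: (eqVneq j' j) => [jj'|j'j].
  rewrite jj' in h' ij' *; rewrite mulr1 mulr0 subr0.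
  rewrite (area3 i j i')// ?(sym i')// in h.
  rewrite (area3 i' j i)// ?ji// in h'.
  apply: key h _; move: h'; congr (0 < _ * (_ * _)).
  by apply: eq_bigl => l; do 3!case: (l == _).
have area4 a b c d : a != b -> a != c -> b != c -> a != d -> b != d -> c != d ->
   area_sign a b x =
   wedge a b * (x c * x d * \prod_(l | [&& l != a, l != b, l != c & l != d]) x l).
  move=> ab ac bc ad bd cd; rewrite (area3 a b c)// (bigD1 d) ?(eq_sym d) ?ad ?bd ?cd//=.
  rewrite -(mulrA (x c)); congr (_ * (_ * (_ * _))); apply: eq_bigl => l.
  by rewrite -!andbA.
have xi' : x i' != 0.
  by apply: contraTneq h => e; rewrite (area3 i j i')// ?(sym i')// e mul0r mulr0 ltxx.
have xj' : x j' != 0.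
  by apply: contraTneq h => e; rewrite (area3 i j j')// ?(sym j')// e mul0r mulr0 ltxx.
rewrite (area4 i j i' j')// ?(sym i') ?(sym j')// in h.
rewrite (area4 i' j' i j)// in h'.
rewrite (_ : _ - _ = wedge i' j' / wedge i j * (x i * x j / (x i' * x j'))).
  apply: key h _; move: h'; congr (0 < _ * (_ * _)).
  by apply: eq_bigl => l; do 4!case: (l == _).
have plucker : wedge i' j * wedge i j' - wedge i i' * wedge j' j = wedge i' j' * wedge i j.
  by rewrite /wedge; ring.
transitivity ((wedge i' j * wedge i j' - wedge i i' * wedge j' j) / wedge i j ^+ 2
   * (x i * x j / (x i' * x j'))); first by field; rewrite xi' xj' w0.
by rewrite plucker; field; rewrite xi' xj' w0.
Qed.

(** Both orders of a pair are offered: swapping [i] and [j] changes the sign of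
    [area_sign], so that one of the two charts has the right orientation. *)
Definition corner_atlas : set (chart R surf) :=
  [set c | exists i j s (w : wedge i j != 0),
    0 < area_sign i j (sgn R s) /\ c = corner_chart s w].

Lemma area_sign_dom i j s (x : surf) : corner_dom i j s x ->
  (0 < area_sign i j (fun l => crd l x)) = (0 < area_sign i j (sgn R s)).
Proof.
move=> xd; rewrite /area_sign -(pmulr_lgt0 (wedge i j * \prod_(l | _) sgn R s l)
  (_ : 0 < \prod_(l | (l != i) && (l != j)) (sgn R s l * crd l x))); last first.
  by apply: prodr_gt0 => l /andP[]; exact: xd.
congr (0 < _); rewrite big_split /= mulrA; congr (_ * _).
rewrite -mulrA -big_split /= big1 ?mulr1// => l _.
by rewrite -expr2 sqrr_sign.
Qed.

Lemma corner_atlas_oriented c c' (x : surf) : corner_atlas c -> corner_atlas c' ->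
    chart_dom c x -> chart_dom c' x ->
  orientation_preserving_at (chart_map c' \o chart_inv c) (chart_map c x).
Proof.
move=> [i [j [s [w [pos ->]]]]] [i' [j' [s' [w' [pos' ->]]]]] /= xd xd'.
set q0 := corner_map i j x.
have q0c : corner_cod i j q0 by exact: (corner_map_cod w xd).
have near_cod : \forall q \near q0, corner_cod i j q.
  by apply: open_nbhs_nbhs; split=> //; exact: open_corner_cod.
have rowE : (fun l => chart_row i j s q0 0 l) = fun l => crd l x.
  by apply/funext => l; rewrite -(crd_corner_inv s w)// corner_mapK.
have [a [b [ca cb a0 b0 ab]]] := chart_row_secant s i' w q0c.
have [c1 [d [cc cd' c0 d0 cdE]]] := chart_row_secant s j' w q0c.
apply: (orientation_preserving_secant ca cb cc cd').
- near=> q; have qc : corner_cod i j q by near: q.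
  have ci := @corner_inv_continuous i j s w _ (mem_set qc).
  exact: (continuous_comp ci (@corner_map_continuous i' j' _)).
- near=> q; have qc : corner_cod i j q by near: q.
  by rewrite /= !crd_corner_inv// ab.
- near=> q; have qc : corner_cod i j q by near: q.
  by rewrite /= !crd_corner_inv// cdE.
rewrite a0 b0 c0 d0 rowE; apply: slope_det_gt0.
  by rewrite (area_sign_dom xd).
by rewrite (area_sign_dom xd').
Unshelve. all: by end_near. Qed.

(** The analogue for lines of a simple polytope: at most two sides pass through a
    point, and two that do are transversal. *)
Definition simple_sides := forall p, exists i j, wedge i j != 0 /\
  forall l, side l p = 0 -> l = i \/ l = j.

Lemma corner_atlas_cover : simple_sides -> atlas corner_atlas.
Proof.
move=> simple x; have [p xp] := crdP x; have [i [j [w ijp]]] := simple p.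
have xd : corner_dom i j (signs x) x.
  move=> l li lj; rewrite lt_neqAle signsP andbT eq_sym mulf_neq0 ?signr_eq0//.
  apply: contra_neqN li => /eqP xl.
  have pl : side l p = 0 by rewrite -xp xl expr0n.
  by case: (ijp l pl) => // lj'; move: lj; rewrite lj' eqxx.
have [pos|neg] := ltP 0 (area_sign i j (sgn R (signs x))).
  exists (corner_chart (signs x) w) => //.
  by exists i, j, (signs x), w.
have w' : wedge j i != 0 by rewrite wedgeC oppr_eq0.
exists (corner_chart (signs x) w').
  exists j, i, (signs x), w'; split=> //.
  rewrite /area_sign wedgeC mulNr oppr_gt0 lt_neqAle; apply/andP; split.
    by rewrite mulf_neq0//; apply/prodf_neq0 => l _; rewrite signr_eq0.
  move: neg; congr (_ * _ <= 0); apply: eq_bigl => l; exact: andbC.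
by move=> l lj li; exact: xd.
Qed.

Hypothesis nrm_unit : forall l, (nrm l).1 ^+ 2 + (nrm l).2 ^+ 2 = 1.
Hypothesis nrm_inj : injective nrm.
Hypothesis nrm_quarter : forall l, exists l', nrm l' = (- (nrm l).2, (nrm l).1).
Variable l0 : 'I_k.

(** The sides are tangent to the unit circle at the points [- n_l].  If a third
    side passes through [p], then [n_l = b n_i + c n_j], where [b + c = 1]
    because of the equations of the three sides.  As [n_l] is a unit vector,
    [b c = 0]: a line meets the circle in at most two points. *)
Lemma two_tangents p i j : i != j -> side i p = 0 -> side j p = 0 ->
  wedge i j != 0 /\ forall l, side l p = 0 -> l = i \/ l = j.
Proof.
rewrite /side => ij pi pj.
have ui := nrm_unit i; have uj := nrm_unit j.
have d1 : (nrm i).1 * (nrm j).1 + (nrm i).2 * (nrm j).2 != 1.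
  apply: contraNneq ij => d; apply/eqP/nrm_inj.
  have : ((nrm i).1 - (nrm j).1) ^+ 2 + ((nrm i).2 - (nrm j).2) ^+ 2 = 0 by nra.
  move/eqP; rewrite paddr_eq0 ?sqr_ge0// !sqrf_eq0 !subr_eq0 => /andP[/eqP e1 /eqP e2].
  by rewrite (surjective_pairing (nrm i)) e1 e2 -surjective_pairing.
have w : wedge i j != 0.
  apply: contraNneq d1 => w0; set d := _ + _.
  have e1 : (nrm i).1 = d * (nrm j).1 + wedge i j * (nrm j).2.
    by rewrite -[LHS]mulr1 -uj /d /wedge; ring.
  have e2 : (nrm i).2 = d * (nrm j).2 - wedge i j * (nrm j).1.
    by rewrite -[LHS]mulr1 -uj /d /wedge; ring.
  move: pi; rewrite e1 e2 w0 !mul0r addr0 subr0 -!mulrA -mulrDr => pi.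
  have pj' : (nrm j).1 * p.1 + (nrm j).2 * p.2 = - 1 by lra.
  by move: pi; rewrite pj' mulrN1 => /eqP; rewrite subr_eq0 eq_sym.
split=> // l pl; have ul := nrm_unit l.
pose b := wedge l j / wedge i j; pose c := wedge i l / wedge i j.
have e1 : (nrm l).1 = b * (nrm i).1 + c * (nrm j).1.
  by move: w; rewrite /b /c /wedge => w; field.
have e2 : (nrm l).2 = b * (nrm i).2 + c * (nrm j).2.
  by move: w; rewrite /b /c /wedge => w; field.
clearbody b c; have bc : b + c = 1.
  transitivity (1 - (1 + ((nrm l).1 * p.1 + (nrm l).2 * p.2)) +
      b * (1 + ((nrm i).1 * p.1 + (nrm i).2 * p.2)) +
      c * (1 + ((nrm j).1 * p.1 + (nrm j).2 * p.2))); first by rewrite e1 e2; ring.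
  by rewrite pl pi pj; ring.
have : b * c * (1 - ((nrm i).1 * (nrm j).1 + (nrm i).2 * (nrm j).2)) = 0.
  set d := (nrm i).1 * (nrm j).1 + (nrm i).2 * (nrm j).2.
  have : b ^+ 2 + c ^+ 2 + 2 * (b * c * d) = 1.
    transitivity (b ^+ 2 * ((nrm i).1 ^+ 2 + (nrm i).2 ^+ 2) +
      c ^+ 2 * ((nrm j).1 ^+ 2 + (nrm j).2 ^+ 2) + 2 * (b * c * d)).
      by rewrite ui uj; ring.
    by rewrite -[RHS]ul e1 e2 /d; ring.
  have : (b + c) ^+ 2 = 1 by rewrite bc expr1n.
  rewrite sqrrD mulrBr mulr1; lra.
move/eqP; rewrite !mulf_eq0 [1 - _ == 0]subr_eq0 [1 == _]eq_sym (negbTE d1) orbF.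
have nrmE a : (nrm l).1 = (nrm a).1 -> (nrm l).2 = (nrm a).2 -> l = a.
  move=> f1 f2; apply: nrm_inj.
  by rewrite (surjective_pairing (nrm l)) f1 f2 -surjective_pairing.
case/orP => /eqP z; [right|left]; apply: nrmE; rewrite ?e1 ?e2 z; move: bc; rewrite z.
- by rewrite add0r => ->; ring.
- by rewrite add0r => ->; ring.
- by rewrite addr0 => ->; ring.
- by rewrite addr0 => ->; ring.
Qed.

Lemma nrm_simple_sides : simple_sides.
Proof.
move=> p.
have [[i [j [ij pi pj]]]|none] :=
  pselect (exists i j, [/\ i != j, side i p = 0 & side j p = 0]).
  by exists i, j; exact: two_tangents.
have transversal i : exists j, wedge i j != 0.
  have [j nj] := nrm_quarter i; exists j.
  by rewrite /wedge nj /= mulrN opprK -!expr2 nrm_unit oner_eq0.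
have [[i pi]|none1] := pselect (exists i, side i p = 0).
  have [j w] := transversal i; exists i, j; split=> // l pl; left.
  by apply/eqP/negPn/negP => li; apply: none; exists l, i.
have [j w] := transversal l0.
by exists l0, j; split=> // l pl; case: none1; exists l.
Qed.

End Charts.

Lemma surf_closed_connected_orientable (R : realType) (k : nat)
    (nrm : 'I_k -> R * R) (l0 : 'I_k) :
    (forall l, (nrm l).1 ^+ 2 + (nrm l).2 ^+ 2 = 1) -> injective nrm ->
    (forall l, exists l', nrm l' = (- (nrm l).2, (nrm l).1)) ->
  closed_connected_orientable_surface R (surf nrm).
Proof.
move=> unit inj quarter.
have cover := corner_atlas_cover (nrm_simple_sides unit inj quarter l0).
have cpt := surf_compact unit quarter l0.
split=> //.
- split; [exact: surf_hausdorff|exact: (compact_second_countable cpt)|].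
  by exists (@corner_atlas _ _ nrm).
- by exists (base_point nrm).
- exact: surf_connected.
- by exists (@corner_atlas _ _ nrm); split=> // c c' x; exact: corner_atlas_oriented.
Qed.

(** * Periodic maps of the surface from symmetries of the polygon *)

Section Relabel.
Variables (R : realType) (k : nat) (nrm : 'I_k -> R * R).
Variables (sigma : 'I_k -> 'I_k) (rot : R * R -> R * R).
Hypothesis side_sigma : forall l p, side nrm (sigma l) p = side nrm l (rot p).

Definition relabel_row (x : surf nrm) : 'rV[R]_k := \row_l crd (sigma l) x.
Definition relabel (x : surf nrm) : surf nrm := to_surf nrm (relabel_row x).

Lemma crd_relabel l x : crd l (relabel x) = crd (sigma l) x.
Proof.
rewrite {1}/crd to_surfK ?mxE//; have [p xp] := crdP x.
by exists (rot p) => i; rewrite mxE xp side_sigma.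
Qed.

Lemma relabel_continuous : continuous relabel.
Proof.
apply: (@continuous_comp_initial (surf nrm) _ _ val) => x.
apply: continuous_row => l.
rewrite (_ : (fun _ => _) = crd (sigma l)); first exact: crd_continuous.
by apply/funext => y; rewrite -crd_relabel.
Qed.

Lemma crd_iter_relabel t l x : crd l (iter t relabel x) = crd (iter t sigma l) x.
Proof.
elim: t l => //= t IHt l; rewrite crd_relabel IHt; congr (crd _ x).
by rewrite -iterSr.
Qed.

Lemma iter_relabel_continuous t : continuous (iter t relabel).
Proof.
elim: t => [|t IHt] x; first exact: cvg_id.
by apply: continuous_comp; [exact: IHt|exact: relabel_continuous].
Qed.

Lemma relabel_periodic t : (0 < t)%N -> (forall l, iter t sigma l = l) ->
  periodic_map relabel.
Proof.
move=> t0 st; have it : iter t relabel = id.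
  by apply/funext => x; apply: crd_inj => l; rewrite crd_iter_relabel st.
split; last by exists t.
split; first exact: relabel_continuous.
exists (iter t.-1 relabel); split; first exact: iter_relabel_continuous.
- by move=> x; rewrite -iterSr prednK// it.
- by move=> x; rewrite -iterS prednK// it.
Qed.

End Relabel.

(** * The regular polygon *)

Section RegularPolygon.
Variables (R : realType) (k : nat).
Hypothesis k_gt0 : (0 < k)%N.

Definition regular_angle (a : nat) : R := a%:R * (2 * pi / k%:R).

Definition regular_normal (l : 'I_k) : R * R :=
  (cos (regular_angle l), sin (regular_angle l)).

Definition advance (a : nat) (l : 'I_k) : 'I_k := Ordinal (ltn_pmod (l + a) k_gt0).

Lemma iter_advance t l : iter t (advance 1) l = advance t l.
Proof.
elim: t => [|t IHt] /=; first by apply: val_inj; rewrite /= addn0 modn_small.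
by apply: val_inj; rewrite IHt /= modnDml -addnA addn1.
Qed.

Let k_neq0 : k%:R != 0 :> R.
Proof. by rewrite pnatr_eq0 -lt0n. Qed.

Lemma regular_angle_modn a : regular_angle a = regular_angle (a %% k) + pi *+ 2 *+ (a %/ k).
Proof.
rewrite {1}(divn_eq a k) /regular_angle natrD natrM.
by rewrite -[_ *+ (a %/ k)]mulr_natl -[pi *+ 2]mulr_natl; field.
Qed.

Lemma regular_normal_advance a l : regular_normal (advance a l) =
  (cos (regular_angle l + regular_angle a), sin (regular_angle l + regular_angle a)).
Proof.
have -> : regular_angle l + regular_angle a = regular_angle (l + a).
  by rewrite /regular_angle -mulrDl -natrD.
rewrite (regular_angle_modn (l + a)).
by rewrite (periodicn (@cosD2pi R)) (periodicn (@sinD2pi R)).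
Qed.

Lemma regular_normal_unit l : (regular_normal l).1 ^+ 2 + (regular_normal l).2 ^+ 2 = 1.
Proof. exact: cos2Dsin2. Qed.

(** If two of the angles had the same cosine and sine, half of their difference
    would be an angle strictly between 0 and [pi] whose sine is zero. *)
Lemma regular_normal_inj : injective regular_normal.
Proof.
have lt_neq (i j : 'I_k) : (i < j)%N -> regular_normal i <> regular_normal j.
  move=> ij [ci si]; pose h := (regular_angle j - regular_angle i) / 2.
  have hE : h = (j - i)%:R * (pi / k%:R).
    by rewrite /h /regular_angle natrB ?(ltnW ij)//; field.
  have h0 : 0 < sin h.
    apply: sin_gt0_pi; rewrite hE mulr_gt0 ?ltr0n ?subn_gt0//=; last first.
      by rewrite divr_gt0 ?pi_gt0 ?ltr0n.
    rewrite mulrCA -[ltRHS]mulr1 ltr_pM2l ?pi_gt0// ltr_pdivrMr ?ltr0n// mul1r.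
    by rewrite ltr_nat (leq_ltn_trans (leq_subr _ _)).
  have : cos (h *+ 2) = 1.
    rewrite (_ : h *+ 2 = regular_angle j - regular_angle i); last first.
      by rewrite /h -mulr_natr divfK.
    by rewrite cosB ci si -!expr2 cos2Dsin2.
  have := cos2Dsin2 h; rewrite cos_mulr2n; nra.
move=> i j nij; apply/val_inj/eqP; case: ltngtP => // ij.
  by case: (lt_neq _ _ ij).
by case: (lt_neq _ _ ij).
Qed.

Lemma regular_normal_quarter l : (4 %| k)%N ->
  exists l', regular_normal l' = (- (regular_normal l).2, (regular_normal l).1).
Proof.
move=> k4; exists (advance (k %/ 4) l); rewrite regular_normal_advance.
rewrite (_ : regular_angle (k %/ 4) = pi / 2) ?cosDpihalf ?sinDpihalf//.
rewrite /regular_angle -{2}(divnK k4) natrM; field.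
by rewrite pnatr_eq0 -lt0n divn_gt0// dvdn_leq.
Qed.

Lemma side_regular_advance l p : side regular_normal (advance 1 l) p =
  side regular_normal l
    (cos (regular_angle 1) * p.1 + sin (regular_angle 1) * p.2,
     cos (regular_angle 1) * p.2 - sin (regular_angle 1) * p.1).
Proof. by rewrite /side regular_normal_advance /= cosD sinD; ring. Qed.

End RegularPolygon.

Theorem corollary1p5 (R : realType) (m : nat) (hm : (0 < m)%N) :
  exists (F : topologicalType) (f : F -> F),
    closed_connected_orientable_surface R F /\ periodic_map f /\
    ~ exists e : F -> 'cV[R]_m, equivariant_embedding f e.
Proof.
(* [k] is kept opaque, for the unary number [2 ^ m.+1] should not be unfolded. *)
have [k kE] : exists k, k = (2 ^ m.+1)%N by exists (2 ^ m.+1)%N.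
have k_gt0 : (0 < k)%N by rewrite kE expn_gt0.
have k4 : (4 %| k)%N.
  by rewrite kE -[4%N]/(2 ^ 2)%N dvdn_exp2l.
pose nrm := @regular_normal R k.
pose f := relabel (nrm := nrm) (advance k_gt0 1).
have fE := crd_iter_relabel (side_regular_advance k_gt0) : forall t l (x : surf nrm), _.
exists (surf nrm), f; split; [|split].
- apply: (surf_closed_connected_orientable (Ordinal k_gt0)).
  + exact: regular_normal_unit.
  + exact: regular_normal_inj.
  + by move=> l; exact: regular_normal_quarter.
- apply: (relabel_periodic (side_regular_advance k_gt0) k_gt0) => l.
  by rewrite iter_advance; apply: val_inj; rewrite /= modnDr modn_small.
case=> e [[_ e_inj _] [rho [_ _ rhoE]]].
(* The sign vector that is negative exactly at the multiples of [2 ^ t]; its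
   smallest period is [2 ^ t]. *)
pose word t : 'rV[R]_k := \row_l (-1) ^+ (2 ^ t %| l).
have wordP t : moment_angle nrm (word t).
  by exists (0, 0) => l; rewrite mxE sqrr_sign /side /=; ring.
pose x t := to_surf nrm (word t).
have xE t l : crd l (x t) = (-1) ^+ (2 ^ t %| l).
  by rewrite /crd to_surfK// mxE.
suff : (m.+1 <= m)%N by rewrite ltnn.
apply: (@linear_orbit_chain_le_dim _ _ _ _ f e (rho f) x) => //.
- by move=> y; apply: rhoE; exists 1%N.
- move=> t tm; apply: crd_inj => l; rewrite fE iter_advance !xE /=.
  have tk : (2 ^ t %| k)%N by rewrite kE dvdn_exp2l.
  by rewrite /dvdn modn_dvdm // modnDr.
(* Shifted by [2 ^ t], the word [t.+1] changes its first letter, as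
   [2 ^ t.+1] divides 0 and not [2 ^ t]. *)
move=> t tm /(congr1 (crd (Ordinal k_gt0))); rewrite fE iter_advance !xE /= add0n.
rewrite modn_small ?kE ?ltn_exp2l// dvdn0 dvdn_Pexp2l// ltnn expr0 expr1 => /eqP.
by rewrite eq_sym -subr_eq0 -opprD oppr_eq0 -mulr2n pnatr_eq0.
Qed.
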